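(* Let $G$ be a connected orientable ribbon graph with root vertex $\bar v$, data as in the context, and let $e$ be an edge joining two distinct vertices $v_1,v_2$ such that $G-e$ is connected. Then $$\det M_G=\alpha_e\det M_{G-e}+\det M_{G/e}.$$ (If $G-e$ is disconnected, the identity holds with $\det M_{G-e}:=0$.)
   Context: Ribbon graph: finite graph (loops, multiple edges allowed) with, at each vertex, a cyclic order of its incident half-edges. Orient each edge arbitrarily. At each vertex $v$ choose a linear order of its half-edge positions $1,\dots,\deg v$ compatible with the cyclic order. For an edge $e$, vertex $v$ and position $i$: $\varepsilon^v_{ei}=+1$ if $e$ starts at position $i$ of $v$, $-1$ if it ends there, $0$ otherwise (a self-loop has both a $+1$ and a $-1$ at its vertex). Fix $\theta>0$ and edge parameters $\alpha_e$. For edges $e,e'$ set $f_{ee'}=-\frac{\theta}{4}\sum_v\sum_{i,j}\mathrm{sgn}(j-i)\,\varepsilon^v_{ei}\varepsilon^v_{e'j}$ (antisymmetric, $f_{ee}=0$). $M_G$ is the square matrix indexed by $E\sqcup(V\setminus\{\bar v\})$ with $(M_G)_{ee}=\alpha_e$, $(M_G)_{ee'}=f_{ee'}$ for $e\neq e'$, $(M_G)_{ev}=-\sum_i\varepsilon^v_{ei}$, $(M_G)_{ve}=\sum_i\varepsilon^v_{ei}$, $(M_G)_{vv'}=0$. (Its determinant is the first noncommutative Symanzik polynomial $U^\star_G$.) $G-e$: remove $e$ (the cyclic orders at $v_1,v_2$ lose the half-edge of $e$). $G/e$ (ribbon contraction): if the cyclic order at $v_1$ is $(e,h_1,\dots,h_k)$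 and at $v_2$ is $(e,h'_1,\dots,h'_m)$, remove $e$ and replace $v_1,v_2$ by one vertex with cyclic order $(h_1,\dots,h_k,h'_1,\dots,h'_m)$; this vertex is the root if $\bar v\in\{v_1,v_2\}$. Linear orders compatible with the cyclic orders are chosen at the vertices of $G-e$ and $G/e$. *)

(* Defs.v *)
From HB Require Import structures.
From mathcomp Require Import all_boot all_order all_algebra.
Unset Printing Implicit Defensive.
Import Order.TTheory GRing.Theory Num.Theory.

(* A ribbon graph with oriented edges, given by:
   - nE : number of edges, edges are 0..nE-1;
   - rots : one sequence per vertex (vertices are 0..size rots - 1); the
     sequence lists the half-edges at that vertex in a LINEAR order compatible
     with the cyclic order (the cyclic order is the rotation class);
     a half-edge is (e, true) if edge e starts there, (e, false) if it ends there;
   - root : the root vertex \bar v. *)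
Record ribbon := Ribbon { nE : nat; rots : seq (seq (nat * bool)); root : nat }.

Definition nV (G : ribbon) := size (rots G).
Definition rotv (G : ribbon) (v : nat) := nth [::] (rots G) v.

Definition wf (G : ribbon) : Prop :=
  [/\ root G < nV G,
      (forall (e : nat) (b : bool), e < nE G ->
         \sum_(s <- rots G) count_mem (e, b) s = 1)
    & (forall s h, s \in rots G -> h \in s -> h.1 < nE G)].

Definition src (G : ribbon) (e : nat) := find (fun s => (e, true) \in s) (rots G).
Definition tgt (G : ribbon) (e : nat) := find (fun s => (e, false) \in s) (rots G).

Definition adj (G : ribbon) : rel 'I_(nV G) := fun u v =>
  [exists e : 'I_(nE G),
    ((src G e == u) && (tgt G e == v)) || ((src G e == v) && (tgt G e == u))].

Definition connectedG (G : ribbon) : Prop :=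
  forall u v : 'I_(nV G), connect (adj G) u v.

Section Mat.
Local Open Scope ring_scope.
Variable R : realFieldType.

Definition eps (s : seq (nat * bool)) (e i : nat) : R :=
  ((nth (0%N, true) s i == (e, true))%:R - (nth (0%N, true) s i == (e, false))%:R).

Definition sgnd (i j : nat) : R :=
  if (i < j)%N then 1 else if (j < i)%N then -1 else 0.

Definition fcoef (theta : R) (G : ribbon) (e e' : nat) : R :=
  - (theta / 4%:R) *
    \sum_(v < nV G) \sum_(i < size (rotv G v)) \sum_(j < size (rotv G v))
      sgnd i j * eps (rotv G v) e i * eps (rotv G v) e' j.

Definition inc (G : ribbon) (v e : nat) : R :=
  \sum_(i < size (rotv G v)) eps (rotv G v) e i.

(* M_G, indexed by E ⊔ (V \ {root}); index j of the second block stands for the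
   non-root vertex bump (root G) j *)
Definition MG (theta : R) (alpha : nat -> R) (G : ribbon)
  : 'M[R]_(nE G + (nV G).-1) :=
  \matrix_(a, b)
    match split a, split b with
    | inl e, inl e' => if e == e' then alpha e else fcoef theta G e e'
    | inl e, inr j => - inc G (bump (root G) j) e
    | inr j, inl e => inc G (bump (root G) j) e
    | inr _, inr _ => 0
    end.

Definition detMG (theta : R) (alpha : nat -> R) (G : ribbon) : R :=
  \det (MG theta alpha G).
End Mat.
Arguments eps {R}. Arguments sgnd {R}. Arguments fcoef {R}. Arguments inc {R}. Arguments MG {R}. Arguments detMG {R}.

Definition relabel (e : nat) (h : nat * bool) : nat * bool :=
  (if h.1 < e then h.1 else h.1.-1, h.2).

Definition alpha_rm (T : Type) (alpha : nat -> T) (e : nat) : nat -> T :=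
  fun i => alpha (if i < e then i else i.+1).

Definition del (G : ribbon) (e : nat) : ribbon :=
  Ribbon (nE G).-1
    [seq map (relabel e) [seq h <- s | h.1 != e] | s <- rots G] (root G).

(* G / e (ribbon contraction), for e from v1 = src to v2 = tgt, v1 <> v2:
   v1's order rotated to (e,h1..hk), v2's to (e,h'1..h'm); the merged vertex
   (h1..hk,h'1..h'm) replaces v1, v2 is deleted, vertices renumbered. *)
Definition contr (G : ribbon) (e : nat) : ribbon :=
  let v1 := src G e in let v2 := tgt G e in
  let s1 := rotv G v1 in let s2 := rotv G v2 in
  let m1 := behead (rot (index (e, true) s1) s1) in
  let m2 := behead (rot (index (e, false) s2) s2) in
  let phi v := (let w := if v == v2 then v1 else v in if w < v2 then w else w.-1) in
  Ribbon (nE G).-1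
    [seq map (relabel e) [seq h <- (if v == v1 then m1 ++ m2 else rotv G v) | h.1 != e]
      | v <- [seq v <- iota 0 (nV G) | v != v2]]
    (phi (root G)).

(* choose other linear orders compatible with the same cyclic orders:
   vertex v's sequence is rotated by r v *)
Definition rerot (r : nat -> nat) (G : ribbon) : ribbon :=
  Ribbon (nE G) [seq rot (r v) (rotv G v) | v <- iota 0 (nV G)] (root G).
Arguments alpha_rm {T}.

(* Main.v *)
Require Import Defs.
From HB Require Import structures.
From mathcomp Require Import all_boot all_order all_algebra.
From mathcomp Require Import perm ring zify.
Import Order.TTheory GRing.Theory Num.Theory.
Local Open Scope ring_scope.

(* Let B be the incidence matrix with a row for every vertex, the root included,
   and A the edge block of M_G. The columns of B sum to zero, so det M_G is the
   determinant of [[A, -B^T], [B, u u^T]], with u the indicator of the root. A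
   congruence by [[1, L], [0, 1]] with L u = 0 shows that this determinant is
   unchanged when A is replaced by A + L B - B^T L^T, and a congruence by a
   unimodular P on the vertices shows that the choice of the root is immaterial.

   Rotating the linear order at a vertex, and concatenating the orders of two
   vertices that get merged, both change the edge block by such a term
   L B - B^T L^T. The determinant is affine in alpha_e; its slope is the minor
   without e, which is det M_{G-e}. At alpha_e = 0, with e first in the order at
   both of its ends, one more L B - B^T L^T clears the row and column of e in A.
   Adding the row of v2 to that of v1 then leaves e coupled to v2 only, so both
   can be expanded away, and what remains is M_{G/e}. *)

(** * Reindexing of block matrices *)

Definition sum_ord n n' m m' (f : 'I_n -> 'I_n') (g : 'I_m -> 'I_m')
    (x : 'I_(n + m)) : 'I_(n' + m') :=
  match split x with inl i => lshift m' (f i) | inr j => rshift n' (g j) end.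

Lemma sum_ordl n n' m m' f g i : sum_ord n n' m m' f g (lshift m i) = lshift m' (f i).
Proof. by rewrite /sum_ord -/(unsplit (inl i)) unsplitK. Qed.

Lemma sum_ordr n n' m m' f g j : sum_ord n n' m m' f g (rshift n j) = rshift n' (g j).
Proof. by rewrite /sum_ord -/(unsplit (inr j)) unsplitK. Qed.

Lemma sum_ord_inj n n' m m' f g :
  injective f -> injective g -> injective (sum_ord n n' m m' f g).
Proof.
move=> f_inj g_inj x y; case: (split_ordP x) => i ->; case: (split_ordP y) => j ->;
  rewrite ?sum_ordl ?sum_ordr; last 1 first.
- by move/rshift_inj/g_inj->.
- by move/lshift_inj/f_inj->.
- by move/eqP; rewrite eq_lrshift.
- by move/eqP; rewrite eq_rlshift.
Qed.

Lemma lshift_neq_sum_ord n n' m m' f g i x :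
  (forall j, i != f j) -> lshift m' i != sum_ord n n' m m' f g x.
Proof.
by move=> iNf; case: (split_ordP x) => j ->; rewrite ?sum_ordl ?sum_ordr ?eq_lrshift
  ?eq_lshift.
Qed.

Lemma rshift_neq_sum_ord n n' m m' f g i x :
  (forall j, i != g j) -> rshift n' i != sum_ord n n' m m' f g x.
Proof.
by move=> iNg; case: (split_ordP x) => j ->; rewrite ?sum_ordl ?sum_ordr ?eq_rlshift
  ?eq_rshift.
Qed.

(** Deleting a row and a column inside one block is [mxsub] along a [sum_ord] of [lift] and [id];
    this way the minor is visibly a block matrix again, with no cast between [n + m.+1] and
    [(n + m).+1]. *)
Lemma mxsub_block (T : Type) n n' m m' (f : 'I_n -> 'I_n') (g : 'I_m -> 'I_m')
    (A : 'M[T]_n') B C (D : 'M_m') :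
  mxsub (sum_ord n n' m m' f g) (sum_ord n n' m m' f g) (block_mx A B C D) =
    block_mx (mxsub f f A) (mxsub f g B) (mxsub g f C) (mxsub g g D).
Proof.
apply/matrixP => x y; rewrite mxE.
by case: (split_ordP x) => i ->; case: (split_ordP y) => j ->;
  rewrite ?sum_ordl ?sum_ordr ?block_mxEul ?block_mxEur ?block_mxEdl ?block_mxEdr mxE.
Qed.

(** * Determinants with sparse rows or columns *)

Section Determinants.
Variable R : comNzRingType.

(** An injective self-map of a finite ordinal is a permutation, and its sign enters twice, by rows
    and by columns. *)
Lemma det_mxsub_inj n (f : 'I_n -> 'I_n) (M : 'M[R]_n) :
  injective f -> \det (mxsub f f M) = \det M.
Proof.
move=> f_inj; pose s := perm f_inj.
have -> : mxsub f f M = row_perm s (col_perm s M).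
  by apply/matrixP => i j; rewrite !mxE !permE.
rewrite row_permE col_permE !det_mulmx !det_perm odd_permV mulrCA.
by rewrite -signr_addb addbb mulr1.
Qed.

(** Any injection [f] that avoids [j] enumerates the remaining indices up to a permutation, which is
    harmless by [det_mxsub_inj]. The size is given by an equation so that sums such as [n + m.+1]
    fit. *)
Lemma det_row_diag k l (M : 'M[R]_l) (j : 'I_l) (f : 'I_k -> 'I_l) :
    l = k.+1 -> injective f -> (forall x, j != f x) -> (forall y, y != j -> M j y = 0) ->
  \det M = M j j * \det (mxsub f f M).
Proof.
move=> l_k; subst l; move=> f_inj fNj Mj0.
rewrite (expand_det_row _ j) (bigD1 j) //= big1 => [|i ij].
  pose g x := s2val (unlift_some (fNj x)).
  have gE x : f x = lift j (g x) by rewrite /g; case: unlift_some.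
  rewrite addr0 /cofactor -signr_odd oddD addbb mul1r; congr (_ * _).
  have g_inj : injective g by move=> x y gxy; apply: f_inj; rewrite !gE gxy.
  rewrite -(det_mxsub_inj _ _ _ g_inj); congr (\det _).
  by apply/matrixP => x y; rewrite !mxE !gE.
by rewrite Mj0 // mul0r.
Qed.

Lemma det_col_diag k l (M : 'M[R]_l) (j : 'I_l) (f : 'I_k -> 'I_l) :
    l = k.+1 -> injective f -> (forall x, j != f x) -> (forall y, y != j -> M y j = 0) ->
  \det M = M j j * \det (mxsub f f M).
Proof.
move=> l_k f_inj fNj Mj0; rewrite -det_tr (det_row_diag _ _ _ j f) //=.
  by rewrite mxE -det_tr; congr (_ * \det _); apply/matrixP => x y; rewrite !mxE.
by move=> y yj; rewrite mxE Mj0.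
Qed.

(** Exchanging rows [i] and [j] costs one sign and moves both entries to the diagonal, where column
    [j] and then row [i] can be expanded. *)
Lemma det_row_col_pair k l (M : 'M[R]_l) (i j : 'I_l) (f : 'I_k -> 'I_l) :
    l = k.+2 -> injective f -> i != j -> (forall x, i != f x) -> (forall x, j != f x) ->
    (forall y, y != i -> M j y = 0) -> (forall y, y != i -> M y j = 0) ->
  \det M = - (M i j * M j i) * \det (mxsub f f M).
Proof.
move=> l_k; subst l; move=> f_inj ij fNi fNj Mj0 M0j; have ji : j != i by rewrite eq_sym.
have -> : \det M = - \det (xrow i j M).
  by rewrite xrowE det_mulmx det_perm odd_tperm ij expr1 mulN1r opprK.
rewrite (det_col_diag _ _ _ j (lift j)).
- pose i' := s2val (unlift_some ji).
  have i'E : i = lift j i' by rewrite /i'; case: unlift_some.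
  pose g x := s2val (unlift_some (fNj x)).
  have gE x : f x = lift j (g x) by rewrite /g; case: unlift_some.
  rewrite (det_row_diag _ _ _ i' g).
  + rewrite !mxE -i'E tpermL tpermR mulrA mulNr; congr (- (_ * \det _)).
    apply/matrixP => x y; rewrite !mxE -!gE tpermD //.
  + by [].
  + by move=> x y gxy; apply: f_inj; rewrite !gE gxy.
  + by move=> x; apply: contraNneq (fNi x) => i'x; rewrite gE -i'x -i'E.
  + move=> y yi'; rewrite !mxE -i'E tpermL Mj0 // i'E.
    by apply: contraNneq yi' => /lift_inj ->.
- by [].
- exact: lift_inj.
- by move=> x; apply: neq_lift.
move=> y yj; rewrite !mxE; case: tpermP yj => [_ _|-> /eqP //|/eqP yi _ _];
  by rewrite M0j.
Qed.

(** One unipotent factor makes [N] block triangular from either side: on the left it leaves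
    [1 + x y] in a corner, on the right [1 + y x]. *)
Lemma det_add1_rank1 m (x : 'cV[R]_m) (y : 'rV[R]_m) :
  \det (1%:M + x *m y) = 1 + (y *m x) 0 0.
Proof.
pose N : 'M[R]_(1 + m) := block_mx 1%:M (- y) x 1%:M.
have E1 : block_mx 1%:M 0 (- x) 1%:M *m N = block_mx 1%:M (- y) 0 (1%:M + x *m y).
  rewrite mulmx_block !mul1mx !mul0mx !addr0 !mulmx1 mulNmx mulmxN opprK.
  by rewrite addNr addrC.
have E2 : N *m block_mx 1%:M 0 (- x) 1%:M = block_mx (1%:M + y *m x) (- y) 0 1%:M.
  rewrite mulmx_block !mul1mx !mulmx0 !add0r !mulmx1 mulNmx mulmxN opprK.
  by rewrite addrN.
have := congr1 determinant E1; rewrite det_mulmx det_lblock !det1 !mul1r det_ublock.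
rewrite det1 mul1r => <-; have := congr1 determinant E2.
rewrite det_mulmx det_lblock !det1 !mulr1 det_ublock det1 mulr1 => ->.
by rewrite det_mx11 mxE mxE eqxx.
Qed.

End Determinants.

(** * The bordered determinant and its congruences *)

Section BorderedDeterminant.
Variable R : comNzRingType.

Definition bdet n m (A : 'M[R]_n) (B : 'M_(m, n)) (u : 'cV_m) : R :=
  \det (block_mx A (- B^T) B (u *m u^T)).

(** Multiply by [U] on the left and by its transpose on the right; [L *m u = 0] keeps the border
    block from leaking into the others. *)
Lemma bdet_congr n m (A : 'M[R]_n) (B : 'M_(m, n)) (u : 'cV_m)
    (L : 'M_(n, m)) (P : 'M_m) : L *m u = 0 ->
  bdet n m (A + L *m B - B^T *m L^T) (P *m B) (P *m u) =
    \det P ^+ 2 * bdet n m A B u.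
Proof.
move=> Lu0; pose U := block_mx 1%:M L 0 P.
have detU : \det U = \det P by rewrite det_ublock det1 mul1r.
rewrite /bdet expr2 mulrAC -detU -[X in _ * X]det_tr -!det_mulmx tr_block_mx !mulmx_block.
congr (\det (block_mx _ _ _ _)).
- by rewrite trmx1 !mul1mx mulmx1 mulmxA Lu0 mul0mx addr0 mulNmx.
- by rewrite trmx0 mulmx0 mul1mx mulmxA Lu0 mul0mx add0r addr0 trmx_mul mulNmx.
- rewrite !mul0mx trmx1 !add0r mulmx1 -!mulmxA -trmx_mul Lu0 trmx0.
  by rewrite !mulmx0 addr0.
- by rewrite trmx0 !mul0mx mulmx0 !add0r trmx_mul !mulmxA.
Qed.

(** Since the row of ones kills [B], subtracting multiples of it from the rows of [L] does not
    change [L *m B]; since it sends [u] to 1, the right multiples give a matrix that kills [u], as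
    [bdet_congr] wants. *)
Lemma bdet_form n m (A : 'M[R]_n) (B : 'M_(m, n)) (u : 'cV_m) (L : 'M_(n, m)) :
    const_mx 1 *m B = 0 :> 'rV_n -> const_mx 1 *m u = 1%:M :> 'M_1 ->
  bdet n m (A + L *m B - B^T *m L^T) B u = bdet n m A B u.
Proof.
set o : 'rV_m := const_mx 1 => oB0 ou1; pose L' := L - L *m u *m o.
have L'B : L' *m B = L *m B by rewrite mulmxBl -!mulmxA oB0 !mulmx0 subr0.
have L'u : L' *m u = 0 by rewrite mulmxBl -!mulmxA ou1 mulmx1 subrr.
have := bdet_congr n m A B u L' 1%:M L'u.
by rewrite !mul1mx det1 expr1n mul1r -trmx_mul L'B trmx_mul.
Qed.

Lemma bdet_root n m (A : 'M[R]_n) (B : 'M_(m, n)) (u w : 'cV_m) :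
    const_mx 1 *m B = 0 :> 'rV_n ->
    const_mx 1 *m u = 1%:M :> 'M_1 -> const_mx 1 *m w = 1%:M :> 'M_1 ->
  bdet n m A B w = bdet n m A B u.
Proof.
(* This [P] fixes [B], sends [u] to [w], and has determinant [1 + o (w - u) = 1]. *)
set o : 'rV_m := const_mx 1 => oB0 ou1 ow1; pose P := 1%:M + (w - u) *m o.
have PB : P *m B = B by rewrite mulmxDl mul1mx -mulmxA oB0 mulmx0 addr0.
have Pu : P *m u = w by rewrite mulmxDl mul1mx -mulmxA ou1 mulmx1 addrC subrK.
have detP : \det P = 1.
  by rewrite det_add1_rank1 mulmxBr ou1 ow1 subrr mxE addr0.
have := bdet_congr n m A B u 0 P (mul0mx _ _).
by rewrite PB Pu detP expr1n mul1r mul0mx trmx0 mulmx0 addr0 subr0.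
Qed.

(* Adding all rows to the row of the root clears it up to the border entry. *)
Lemma bdet_row' n m (A : 'M[R]_n) (B : 'M_(m.+1, n)) r :
    const_mx 1 *m B = 0 :> 'rV_n ->
  bdet n m.+1 A B (delta_mx r 0) =
    \det (block_mx A (- (row' r B)^T) (row' r B) 0).
Proof.
set o : 'rV_m.+1 := const_mx 1 => oB0; set u : 'cV_m.+1 := delta_mx r 0.
pose P := 1%:M + u *m (o - u^T).
have uu : u^T *m u = 1%:M.
  by rewrite trmx_delta mul_delta_mx; apply/matrixP => i j; rewrite !mxE !ord1.
have ou : o *m u = 1%:M.
  apply/matrixP => i j; rewrite !ord1 !mxE (bigD1 r) //=.
  rewrite big1 ?addr0 ?mxE ?eqxx ?mulr1 // => k kr.
  by rewrite !mxE (negPf kr) mulr0.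
have Pu : P *m u = u by rewrite mulmxDl mul1mx -mulmxA mulmxBl ou uu subrr mulmx0 addr0.
have detP : \det P = 1 by rewrite det_add1_rank1 mulmxBl ou uu subrr mxE addr0.
have PB i j : (P *m B) i j = (i != r)%:R * B i j.
  rewrite mulmxDl mul1mx -mulmxA mulmxBl oB0 sub0r mulmxN mulmxA mxE [X in _ + X]mxE.
  rewrite trmx_delta mul_delta_mx mxE (bigD1 r) //= big1 => [|k kr]; last first.
    by rewrite mxE (negPf kr) andbF mul0r.
  rewrite mxE eqxx andbT addr0; case: eqP => [->|_]; rewrite ?mul1r ?mul0r ?subrr //.
  by rewrite subr0.
have PBT i j : (- (P *m B)^T) i j = - ((j != r)%:R * B j i).
  by rewrite mxE [X in - X]mxE PB.
have := bdet_congr n m.+1 A B u 0 P (mul0mx _ _).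
rewrite Pu detP expr1n mul1r mul0mx trmx0 mulmx0 addr0 subr0 => <-.
rewrite /bdet (det_row_diag _ _ _ _ (rshift n r) (sum_ord n n m m.+1 id (lift r))).
- rewrite block_mxEdr trmx_delta mul_delta_mx mxE !eqxx mul1r mxsub_block.
  congr (\det (block_mx _ _ _ _)); apply/matrixP => x y; rewrite [LHS]mxE.
  + by [].
  + by rewrite PBT eq_sym neq_lift mul1r !mxE.
  + by rewrite PB eq_sym neq_lift mul1r !mxE.
  + by rewrite !mxE lift_eqF.
- by rewrite addnS.
- by apply: sum_ord_inj => //; apply: lift_inj.
- by move=> x; apply: rshift_neq_sum_ord => j; apply: neq_lift.
move=> y; case: (split_ordP y) => j ->; first by rewrite block_mxEdl PB eqxx mul0r.
by rewrite eq_rshift block_mxEdr trmx_delta mul_delta_mx mxE eqxx /= => /negPf ->.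
Qed.

End BorderedDeterminant.

(** * Deletion and contraction for matrices indexed by natural numbers *)

Section IncidenceDeterminant.
Variable R : fieldType.
Implicit Types a b : nat -> nat -> R.

(* Indexing by natural numbers makes reindexing by [bump] free of casts. *)
Definition incdet n m a b (r : nat) : R :=
  bdet R n m (\matrix_(i, j) a i j) (\matrix_(v, i) b v i)
    (\col_v (v == r :> nat)%:R).

Definition balanced n m b := forall i, (i < n)%N -> \sum_(v < m) b v i = 0.

Lemma eq_incdet n m a a' b b' r :
    (forall i j, (i < n)%N -> (j < n)%N -> a i j = a' i j) ->
    (forall v i, (v < m)%N -> (i < n)%N -> b v i = b' v i) ->
  incdet n m a b r = incdet n m a' b' r.
Proof.
by move=> aa' bb'; congr bdet; apply/matrixP => x y; rewrite !mxE ?aa' ?bb'.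
Qed.

Lemma balancedP n m b : balanced n m b ->
  const_mx 1 *m (\matrix_(v < m, i < n) b v i) = 0 :> 'rV_n.
Proof.
move=> b0; apply/matrixP => x i; rewrite !mxE -[RHS](b0 i) //.
by apply: eq_bigr => v _; rewrite !mxE mul1r.
Qed.

Lemma const_mulmx_indicator m r : (r < m)%N ->
  const_mx 1 *m (\col_(v < m) (v == r :> nat)%:R) = 1%:M :> 'M[R]_1.
Proof.
move=> rm; apply/matrixP => x y; rewrite !ord1 !mxE (bigD1 (Ordinal rm)) //=.
rewrite big1 => [|v /eqP vr]; first by rewrite !mxE eqxx mulr1 addr0.
by rewrite !mxE; case: eqP => [/= E|]; [case: vr; apply: val_inj | rewrite mulr0].
Qed.

Lemma incdet_form n m a b r (lam : nat -> nat -> R) :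
    balanced n m b -> (r < m)%N ->
  incdet n m (fun i j => a i j + \sum_(v < m) (lam i v * b v j - b v i * lam j v)) b r
  = incdet n m a b r.
Proof.
move=> b0 rm; rewrite /incdet.
rewrite -(bdet_form _ _ _ (\matrix_(i, j) a i j) _ _ (\matrix_(i, v) lam i v)).
- congr bdet; apply/matrixP => i j; rewrite !mxE big_split /= sumrN addrA.
  by congr (_ + _ - _); apply: eq_bigr => v _; rewrite !mxE.
- exact: balancedP.
- exact: const_mulmx_indicator.
Qed.

Lemma incdet_root n m a b r r' :
  balanced n m b -> (r < m)%N -> (r' < m)%N -> incdet n m a b r' = incdet n m a b r.
Proof.
by move=> b0 rm rm'; apply: bdet_root; [exact: balancedP | |];
  exact: const_mulmx_indicator.
Qed.

(** The matrix is spelled out in the shape of [MG], so that [detMG] becomes an [incdet] without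
    further matrix computation. *)
Lemma incdet_reduced n m a b r : balanced n m b -> (r < m)%N ->
  \det (\matrix_(x < n + m.-1, y < n + m.-1)
    match split x, split y with
    | inl i, inl j => a i j
    | inl i, inr v => - b (bump r v) i
    | inr v, inl i => b (bump r v) i
    | inr _, inr _ => 0
    end) = incdet n m a b r.
Proof.
case: m => [|m] // b0 rm; pose r' := Ordinal rm.
have -> : incdet n m.+1 a b r =
    bdet R n m.+1 (\matrix_(i, j) a i j) (\matrix_(v, i) b v i) (delta_mx r' 0).
  by congr bdet; apply/matrixP => x y; rewrite !mxE ord1 eqxx andbT.
rewrite bdet_row'; last exact: balancedP.
congr (\det _); apply/matrixP => x y; rewrite mxE /=.
by case: (split_ordP x) => i ->; case: (split_ordP y) => j ->;
  rewrite ?block_mxEul ?block_mxEur ?block_mxEdl ?block_mxEdr !mxE.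
Qed.

(** The row vector with blocks [0] and [z] lies in the left kernel; it meets the border only in
    [z r]. *)
Lemma incdet_kernel n m a b r (z : nat -> R) v0 :
    (v0 < m)%N -> z v0 != 0 -> z r = 0 ->
    (forall i, (i < n)%N -> \sum_(v < m) z v * b v i = 0) ->
  incdet n m a b r = 0.
Proof.
move=> v0m zv0 zr zb; apply/eqP/det0P; exists (row_mx 0 (\row_(v < m) z v)).
  apply: contraNneq zv0 => /matrixP /(_ 0 (rshift n (Ordinal v0m))).
  by rewrite row_mxEr !mxE => ->.
rewrite mul_row_block !mul0mx !add0r mulmxA; set zB := _ *m _; set zu := (X in X *m _^T).
have -> : zB = 0.
  apply/matrixP => x i; rewrite !mxE -[RHS](zb i) //.
  by apply: eq_bigr => v _; rewrite !mxE.
have -> : zu = 0.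
  apply/matrixP => x i; rewrite !mxE big1 // => v _; rewrite !mxE.
  by case: eqP => [->|_]; rewrite ?zr ?mul0r ?mulr0.
by rewrite mul0mx row_mx0.
Qed.

(** By linearity in row [e]: that row is [a e e] times a unit vector plus the same row with its
    diagonal entry set to 0. *)
Lemma incdet_delete n m a b r e : (e < n.+1)%N ->
  incdet n.+1 m a b r =
    a e e * incdet n m (fun i j => a (bump e i) (bump e j)) (fun v i => b v (bump e i)) r
    + incdet n.+1 m (fun i j => if (i == e) && (j == e) then 0 else a i j) b r.
Proof.
move=> en; pose e' := Ordinal en.
pose u : 'cV[R]_m := \col_v (v == r :> nat)%:R.
set D := incdet n m _ _ _; set a0 := fun i j => if _ then 0 else _.
pose N : 'M_(n.+1 + m) := block_mx (\matrix_(i, j) a i j)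
  (- (\matrix_(v, i) b v i)^T) (\matrix_(v, i) b v i) (u *m u^T).
(* [E] is [N] with row [e] replaced by the unit vector at the diagonal. *)
pose E : 'M[R]_(n.+1 + m) := \matrix_(x, y)
  if x == lshift m e' then (y == lshift m e')%:R else N x y.
have -> : D = \det E.
  pose f := sum_ord n n.+1 m m (lift e') id.
  have fNe x : lshift m e' != f x.
    by apply: lshift_neq_sum_ord => j; apply: neq_lift.
  rewrite (det_row_diag _ (n + m) _ _ (lshift m e') f) //.
  - rewrite mxE !eqxx mul1r /D /incdet /bdet; congr (\det _).
    have -> : mxsub f f E = mxsub f f N.
      by apply/matrixP => x y; rewrite !mxE eq_sym (negPf (fNe x)).
    by rewrite mxsub_block; congr block_mx; apply/matrixP => x y; rewrite !mxE.
  - by apply: sum_ord_inj => //; apply: lift_inj.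
  - by move=> y ye; rewrite mxE eqxx (negPf ye).
rewrite -[incdet n.+1 m a0 b r]mul1r.
apply: (determinant_multilinear (i0 := lshift m e')).
- apply/matrixP => x y; rewrite [LHS]mxE [RHS]mxE [X in X + _]mxE [X in _ + X]mxE.
  rewrite [X in _ * X]mxE [E _ _]mxE eqxx [X in _ + 1 * X]mxE mul1r.
  case: (split_ordP y) => j ->; rewrite ?block_mxEul ?block_mxEur ?mxE.
    rewrite eq_lshift /a0 eqxx /=; case: (eqVneq j e') => [->|je].
      by rewrite eqxx mulr1 addr0.
    by rewrite ifN // mulr0 add0r.
  by rewrite eq_rlshift mulr0 add0r.
- by apply/matrixP => x y; rewrite mxE mxE [RHS]mxE lift_eqF.
- apply/matrixP => x y; rewrite [LHS]mxE [RHS]mxE; set x' := lift _ x.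
  case: (split_ordP x') => i xi; case: (split_ordP y) => j ->; rewrite xi;
    rewrite ?block_mxEul ?block_mxEur ?block_mxEdl ?block_mxEdr //.
  rewrite !mxE /a0 ifN // negb_and; apply/orP; left.
  by apply: contraTneq (neq_lift (lshift m e') x) => ie; rewrite -/x' xi
    eq_lshift negbK; apply/eqP/val_inj.
Qed.

(** Once [P] has added row [v2] to row [v1], column [e] of the incidence matrix is -1 at [v2] and 0
    elsewhere, so [det_row_col_pair] removes [e] and [v2] with factor 1. As the root is not [v2],
    [P] fixes its indicator. *)
Lemma incdet_contract n m a b r e v1 v2 :
    (e < n.+1)%N -> (v1 < m.+1)%N -> (v2 < m.+1)%N -> (r < m.+1)%N ->
    v1 != v2 -> r != v2 ->
    (forall i, (i < n.+1)%N -> a e i = 0) -> (forall i, (i < n.+1)%N -> a i e = 0) ->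
    (forall v, (v < m.+1)%N -> b v e = (v == v1)%:R - (v == v2)%:R) ->
  incdet n.+1 m.+1 a b r =
  incdet n m (fun i j => a (bump e i) (bump e j))
    (fun v i => let w := bump v2 v in
      b w (bump e i) + (w == v1)%:R * b v2 (bump e i)) (unbump v2 r).
Proof.
move=> en v1m v2m rm v12 rv2 ae0 a0e be.
pose e' := Ordinal en; pose w1 := Ordinal v1m; pose w2 := Ordinal v2m.
pose u : 'cV[R]_m.+1 := \col_v (v == r :> nat)%:R.
pose A : 'M[R]_n.+1 := \matrix_(i, j) a i j.
pose B : 'M[R]_(m.+1, n.+1) := \matrix_(v, i) b v i.
pose P : 'M[R]_m.+1 := 1%:M + delta_mx w1 (0 : 'I_1) *m delta_mx 0 w2.
have w12 : w1 != w2 by [].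
have detP : \det P = 1.
  by rewrite det_add1_rank1 mul_delta_mx_0 ?mxE ?addr0 // eq_sym.
have PX k (X : 'M[R]_(m.+1, k)) v i : (P *m X) v i = X v i + (v == w1)%:R * X w2 i.
  rewrite mulmxDl mul1mx -mulmxA -rowE mxE; congr (_ + _).
  by rewrite mxE big_ord1 !mxE eqxx andbT.
have Pu : P *m u = u.
  apply/matrixP => v x; rewrite PX !mxE /= [v2 == r]eq_sym (negPf rv2).
  by rewrite mulr0 addr0.
have PBe v : (P *m B) v e' = - (v == w2)%:R.
  rewrite PX !mxE !be //= eqxx [v2 == v1]eq_sym (negPf v12) sub0r mulrN1.
  by rewrite addrAC subrr sub0r.
have PBTe v : (- (P *m B)^T) e' v = (v == w2)%:R.
  by rewrite mxE [X in - X]mxE PBe opprK.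
transitivity (bdet R _ _ A (P *m B) u).
  have := bdet_congr _ n.+1 m.+1 A B u 0 P (mul0mx _ _).
  by rewrite Pu detP expr1n mul1r mul0mx trmx0 mulmx0 addr0 subr0.
pose f := sum_ord n n.+1 m m.+1 (lift e') (lift w2).
rewrite /bdet (det_row_col_pair _ (n + m) _ _ (rshift _ w2) (lshift _ e') f).
- rewrite block_mxEur block_mxEdl PBe PBTe eqxx mulN1r opprK mul1r /f mxsub_block.
  rewrite /incdet /bdet; congr (\det (block_mx _ _ _ _)); apply/matrixP => x y.
  + by rewrite !mxE.
  + rewrite [LHS]mxE [LHS]mxE [X in - X]mxE PX !mxE //.
  + by rewrite [LHS]mxE PX !mxE.
  + rewrite !mxE !big_ord1 !mxE /=.
    have Eb z : (bump v2 z == r) = (z == unbump v2 r).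
      by apply/eqP/eqP => [<-|->]; rewrite ?bumpK ?unbumpK.
    by rewrite !Eb.
- by rewrite addnS.
- by apply: sum_ord_inj; apply: lift_inj.
- by rewrite eq_rlshift.
- by move=> x; apply: rshift_neq_sum_ord => j; apply: neq_lift.
- by move=> x; apply: lshift_neq_sum_ord => j; apply: neq_lift.
- move=> y; case: (split_ordP y) => j ->; first by rewrite block_mxEul mxE ae0.
  by rewrite eq_rshift block_mxEur PBTe => /negPf ->.
- move=> y; case: (split_ordP y) => j ->; first by rewrite block_mxEul mxE a0e.
  by rewrite eq_rshift block_mxEdl PBe => /negPf ->; rewrite oppr0.
Qed.

End IncidenceDeterminant.

(** * Incidence and antisymmetric form of a single half-edge sequence *)

Section HalfEdgeSequences.
Variable R : realFieldType.
Implicit Types s : seq (nat * bool).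

(** The share of one vertex: [inc G v] is convertible to [hinc] of [rotv G v], and [fcoef] to
    [- (theta / 4)] times the sum of the [hform] over the vertices. *)
Definition hinc s e : R := \sum_(i < size s) eps s e i.
Definition hform s e e' : R :=
  \sum_(i < size s) \sum_(j < size s) sgnd i j * eps s e i * eps s e' j.

Lemma eps_catl s1 s2 e i : (i < size s1)%N -> eps (s1 ++ s2) e i = eps s1 e i :> R.
Proof. by move=> i1; rewrite /eps nth_cat i1. Qed.

Lemma eps_catr s1 s2 e i : eps (s1 ++ s2) e (size s1 + i) = eps s2 e i :> R.
Proof. by rewrite /eps nth_cat ltnNge leq_addr /= addKn. Qed.

Lemma hinc_cat s1 s2 e : hinc (s1 ++ s2) e = hinc s1 e + hinc s2 e.
Proof.
rewrite /hinc size_cat big_split_ord /=.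
by congr (_ + _); apply: eq_bigr => i _; rewrite ?eps_catr ?eps_catl ?ltn_ord.
Qed.

(** Every position of [s1] precedes every position of [s2], so the signs of the mixed pairs are
    constant and their sums factor. *)
Lemma hform_cat s1 s2 e e' : hform (s1 ++ s2) e e' =
  hform s1 e e' + hform s2 e e' + hinc s1 e * hinc s2 e' - hinc s2 e * hinc s1 e'.
Proof.
pose T i j := sgnd i j * eps (s1 ++ s2) e i * eps (s1 ++ s2) e' j : R.
have T11 : \sum_(i < size s1) \sum_(j < size s1) T i j = hform s1 e e'.
  by apply: eq_bigr => i _; apply: eq_bigr => j _; rewrite /T !eps_catl.
have T12 : \sum_(i < size s1) \sum_(j < size s2) T i (size s1 + j)%N
    = hinc s1 e * hinc s2 e'.
  rewrite mulr_suml; apply: eq_bigr => i _; rewrite mulr_sumr; apply: eq_bigr => j _.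
  by rewrite /T eps_catl // eps_catr /sgnd ltn_addr // mul1r.
have T21 : \sum_(i < size s2) \sum_(j < size s1) T (size s1 + i)%N j
    = - (hinc s2 e * hinc s1 e').
  rewrite mulr_suml -sumrN; apply: eq_bigr => i _.
  rewrite mulr_sumr -sumrN; apply: eq_bigr => j _.
  rewrite /T eps_catr eps_catl // /sgnd ltnNge ltnW ?ltn_addr //=.
  by rewrite mulN1r mulNr.
have T22 : \sum_(i < size s2) \sum_(j < size s2) T (size s1 + i)%N (size s1 + j)%N
    = hform s2 e e'.
  apply: eq_bigr => i _; apply: eq_bigr => j _.
  by rewrite /T !eps_catr /sgnd !ltn_add2l.
transitivity (\sum_(i < size s1 + size s2) \sum_(j < size s1 + size s2) T i j).
  by rewrite /hform size_cat.
rewrite big_split_ord /=.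
under eq_bigr => i _ do rewrite big_split_ord /=.
under [X in _ + X]eq_bigr => i _ do rewrite big_split_ord /=.
rewrite !big_split /= T11 T12 T21 T22; ring.
Qed.

Lemma hinc_nil e : hinc [::] e = 0.
Proof. by rewrite /hinc big_ord0. Qed.

Lemma hform_nil e e' : hform [::] e e' = 0.
Proof. by rewrite /hform big_ord0. Qed.

Lemma hinc1 h e : hinc [:: h] e = (h == (e, true))%:R - (h == (e, false))%:R.
Proof. by rewrite /hinc big_ord1. Qed.

Lemma hform1 h e e' : hform [:: h] e e' = 0.
Proof. by rewrite /hform !big_ord1 /sgnd ltnn !mul0r. Qed.

Lemma hinc_cons h s e : hinc (h :: s) e = hinc [:: h] e + hinc s e.
Proof. exact: (hinc_cat [:: h]). Qed.

Lemma hform_cons h s e e' : hform (h :: s) e e' =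
  hform s e e' + hinc [:: h] e * hinc s e' - hinc s e * hinc [:: h] e'.
Proof. by rewrite (hform_cat [:: h]) hform1 add0r. Qed.

Lemma hinc_count s e :
  hinc s e = (count_mem (e, true) s)%:R - (count_mem (e, false) s)%:R.
Proof.
elim: s => [|h s IHs]; first by rewrite hinc_nil subrr.
by rewrite hinc_cons IHs hinc1 /= !natrD opprD addrACA.
Qed.

Lemma hform_sym s e e' : hform s e' e = - hform s e e'.
Proof.
elim: s => [|h s IHs]; first by rewrite !hform_nil oppr0.
by rewrite !hform_cons IHs; ring.
Qed.

Lemma hform_notin s e e' : (forall b, (e, b) \notin s) -> hform s e e' = 0.
Proof.
elim: s => [|h s IHs] es; first exact: hform_nil.
have {}IHs : hform s e e' = 0.
  by apply: IHs => b; have := es b; rewrite inE negb_or => /andP[].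
have hs0 t : (forall b, (e, b) \notin t) -> hinc t e = 0.
  by move=> et; rewrite hinc_count !(count_memPn (et _)) subrr.
rewrite hform_cons IHs !hs0 ?mul0r ?subr0 ?addr0 //.
- by move=> b; have := es b; rewrite inE negb_or => /andP[].
- by move=> b; have := es b; rewrite !inE negb_or => /andP[].
Qed.

Lemma hinc_rot k s e : hinc (rot k s) e = hinc s e.
Proof. by rewrite /rot hinc_cat addrC -hinc_cat cat_take_drop. Qed.

(** Exchanging [take k s] and [drop k s] flips the sign of the mixed terms only. The change has the
    form [L B - B^T L^T] that [incdet_form] absorbs. *)
Lemma hform_rot k s e e' : hform (rot k s) e e' =
  hform s e e' + 2 * hinc s e * hinc (take k s) e' - 2 * hinc (take k s) e * hinc s e'.
Proof.
rewrite /rot -{3 4 7}[s](cat_take_drop k) !hform_cat !hinc_cat; ring.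
Qed.

Lemma relabel_eq e h i b : h.1 != e -> (relabel e h == (i, b)) = (h == (bump e i, b)).
Proof.
case: h => x c /= xe; rewrite /relabel !xpair_eqE /=; congr (_ && _).
by rewrite /bump; apply/eqP/eqP; case: ifP; lia.
Qed.

(** The operation on sequences shared by [del] and [contr]. *)
Definition hdel e s := map (relabel e) [seq h <- s | h.1 != e].

Lemma count_hdel e s i b : count_mem (i, b) (hdel e s) = count_mem (bump e i, b) s.
Proof.
rewrite /hdel; elim: s => //= h s IHs; case: (eqVneq h.1 e) => [he|he] /=; rewrite IHs.
  case: h he => x c /= ->; rewrite xpair_eqE.
  by rewrite (negPf (neq_bump e i)).
by rewrite relabel_eq.
Qed.

Lemma hinc_hdel e s i : hinc (hdel e s) i = hinc s (bump e i).
Proof. by rewrite !hinc_count !count_hdel. Qed.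

Lemma hform_hdel e s i j : hform (hdel e s) i j = hform s (bump e i) (bump e j).
Proof.
elim: s => [|h s IHs]; first by rewrite !hform_nil.
have h0 k : h.1 = e -> hinc [:: h] (bump e k) = 0.
  case: h => x c /= ->; rewrite hinc1 !xpair_eqE.
  by rewrite (negPf (neq_bump e k)) subrr.
have -> : hdel e (h :: s) = if h.1 == e then hdel e s else relabel e h :: hdel e s.
  by rewrite /hdel /=; case: eqP.
rewrite [RHS]hform_cons -IHs -!(hinc_hdel e s); case: eqP => [he|/eqP he].
  by rewrite !h0 // mul0r mulr0 addr0 subr0.
by rewrite hform_cons ![hinc [:: relabel e h] _]hinc1 !relabel_eq // -!hinc1.
Qed.

End HalfEdgeSequences.

(** The single occurrence lies in the first sequence that contains [x]. This ties the counting
    clause of [wf] to [src] and [tgt], which are defined by [find]. *)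
Lemma count_mem_find (T : eqType) (x : T) ss :
    (\sum_(s <- ss) count_mem x s = 1)%N ->
  forall v, (v < size ss)%N ->
  count_mem x (nth [::] ss v) = (v == find (fun s => x \in s) ss).
Proof.
elim: ss => [|s ss IHs] //; rewrite big_cons /=; case: ifPn => [xs|/count_memPn xs].
  have : (0 < count_mem x s)%N by rewrite -has_count has_pred1.
  case Es: (count_mem x s) => [|[|c]] // _ [ss0] [|v] //= vs.
  apply/eqP; rewrite -leqn0 -ss0 (big_nth [::]) big_mkord.
  by rewrite (bigD1 (Ordinal (vs : v < size ss)%N)) //= leq_addr.
by rewrite xs add0n => /IHs {}IHs [|v] //= vs; rewrite IHs.
Qed.

(** Both lists are strictly increasing with the same members. It turns the vertex list of [contr]
    into an enumeration by [bump]. *)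
Lemma filter_iota_neq m k : (k < m.+1)%N ->
  [seq v <- iota 0 m.+1 | v != k] = map (bump k) (iota 0 m).
Proof.
move=> km; apply: (@irr_sorted_eq _ ltn ltn_trans ltnn).
- by apply: (sorted_filter ltn_trans); apply: iota_ltn_sorted.
- rewrite sorted_map; apply: (sub_sorted _ (iota_ltn_sorted 0 m)) => i j /= ij.
  by rewrite /bump; lia.
move=> v; rewrite mem_filter mem_iota add0n /=; apply/andP/mapP => [[vk vm]|[i]].
  exists (unbump k v); last by rewrite unbumpK.
  by rewrite mem_iota /unbump; lia.
by rewrite mem_iota => im ->; rewrite eq_sym neq_bump /bump; lia.
Qed.

(** * Rotation, deletion and connectedness of ribbon graphs *)

Section RibbonGraphs.
Variables (R : realFieldType) (theta : R).
Implicit Types (G : ribbon) (alpha : nat -> R).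

Definition halves_once G := forall e b, (e < nE G)%N ->
  (\sum_(s <- rots G) count_mem (e, b) s = 1)%N.

(** Convertible to [src G e] for [true] and to [tgt G e] for [false], so that both ends are treated
    at once. *)
Definition halfv G e b := find (fun s => (e, b) \in s) (rots G).

Lemma count_halfv G e b v : halves_once G -> (e < nE G)%N -> (v < nV G)%N ->
  count_mem (e, b) (rotv G v) = (v == halfv G e b).
Proof. by move=> G1 eG vG; apply: count_mem_find => //; apply: G1. Qed.

Lemma halfv_ltn G e b : halves_once G -> (e < nE G)%N -> (halfv G e b < nV G)%N.
Proof.
move=> G1 eG; rewrite /halfv -has_find; apply: contra_eqT (G1 e b eG) => /hasPn eG0.
by rewrite big_seq big1 // => s /eG0 /count_memPn.
Qed.

Lemma inc_endpoints G e v : halves_once G -> (e < nE G)%N -> (v < nV G)%N ->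
  inc G v e = (v == src G e)%:R - (v == tgt G e)%:R :> R.
Proof.
by move=> G1 eG vG; rewrite -[LHS]/(hinc R _ _) hinc_count !count_halfv.
Qed.

Lemma balanced_inc G : halves_once G -> balanced R (nE G) (nV G) (inc G).
Proof.
move=> G1 e eG; under eq_bigr => v _ do rewrite inc_endpoints //.
rewrite sumrB -!natr_sum.
have E b : (\sum_(v < nV G) (v == halfv G e b :> nat))%N = 1%N.
  rewrite (bigD1 (Ordinal (halfv_ltn G e b G1 eG))) //= eqxx big1 // => v.
  by rewrite -val_eqE /= => /negPf ->.
by rewrite (E true) (E false) subrr.
Qed.

Definition gram alpha G e e' : R := if e == e' then alpha e else fcoef theta G e e'.

Lemma detMG_incdet alpha G :
    (Defs.root G < nV G)%N -> balanced R (nE G) (nV G) (inc G) ->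
  detMG theta alpha G = incdet R (nE G) (nV G) (gram alpha G) (inc G) (Defs.root G).
Proof. by move=> rG G0; rewrite -incdet_reduced. Qed.

Lemma nV_rerot r G : nV (rerot r G) = nV G.
Proof. by rewrite /nV /= size_map size_iota. Qed.

Lemma rotv_rerot r G v : (v < nV G)%N -> rotv (rerot r G) v = rot (r v) (rotv G v).
Proof. by move=> vG; rewrite {1}/rotv /= (nth_map 0%N) ?size_iota // nth_iota. Qed.

Lemma inc_rerot r G v e : (v < nV G)%N -> inc (rerot r G) v e = inc G v e :> R.
Proof. by move=> vG; rewrite -[LHS]/(hinc R _ _) rotv_rerot // hinc_rot. Qed.

(** The matrix [L] for a rotation: [theta / 2] is the [theta / 4] of [fcoef] times the 2 of
    [hform_rot]. *)
Definition rot_shift (r : nat -> nat) G e v : R :=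
  theta / 2 * hinc R (take (r v) (rotv G v)) e.

Lemma fcoef_rerot r G e e' : fcoef theta (rerot r G) e e' =
  fcoef theta G e e' + \sum_(v < nV G)
    (rot_shift r G e v * inc G v e' - inc G v e * rot_shift r G e' v).
Proof.
rewrite -[LHS]/(_ * \sum_(v < nV _) hform R _ _ _).
rewrite -[fcoef theta G e e']/(_ * \sum_(v < nV _) hform R _ _ _).
rewrite nV_rerot !mulr_sumr -big_split /=; apply: eq_bigr => v _.
rewrite rotv_rerot // hform_rot /rot_shift -![inc G v _]/(hinc R _ _).
by field.
Qed.

(** The correction is antisymmetric, hence 0 on the diagonal, where rotation leaves [alpha]
    unchanged. *)
Lemma gram_rerot alpha r G e e' : gram alpha (rerot r G) e e' =
  gram alpha G e e' + \sum_(v < nV G)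
    (rot_shift r G e v * inc G v e' - inc G v e * rot_shift r G e' v).
Proof.
rewrite /gram; case: eqP => [->|_]; last exact: fcoef_rerot.
by rewrite big1 ?addr0 // => v _; rewrite mulrC subrr.
Qed.

Lemma detMG_rerot alpha r G :
    (Defs.root G < nV G)%N -> balanced R (nE G) (nV G) (inc G) ->
  detMG theta alpha (rerot r G) = detMG theta alpha G.
Proof.
move=> rG G0; rewrite !detMG_incdet ?nV_rerot //.
  rewrite -(incdet_form _ _ _ (gram alpha G) _ _ (rot_shift r G)) //.
  by apply: eq_incdet => [i j _ _|v i vG _]; [exact: gram_rerot | exact: inc_rerot].
by move=> e eG; rewrite -[RHS](G0 e) //; apply: eq_bigr => v _; rewrite inc_rerot.
Qed.

Lemma alpha_rm_bump alpha e i : alpha_rm alpha e i = alpha (bump e i).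
Proof. by rewrite /alpha_rm /bump; case: ltnP. Qed.

Lemma nV_del G e : nV (del G e) = nV G.
Proof. by rewrite /nV size_map. Qed.

Lemma rotv_del G e v : (v < nV G)%N -> rotv (del G e) v = hdel e (rotv G v).
Proof. by move=> vG; rewrite /rotv (nth_map [::]). Qed.

Lemma inc_del G e v i : (v < nV G)%N -> inc (del G e) v i = inc G v (bump e i) :> R.
Proof. by move=> vG; rewrite -[LHS]/(hinc R _ _) rotv_del // hinc_hdel. Qed.

Lemma gram_del alpha G e i j : gram (alpha_rm alpha e) (del G e) i j =
  gram alpha G (bump e i) (bump e j).
Proof.
rewrite /gram alpha_rm_bump (inj_eq (can_inj (bumpK e))); case: eqP => // _.
rewrite -[LHS]/(_ * \sum_(v < nV _) hform R _ _ _) nV_del; congr (_ * _).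
by apply: eq_bigr => v _; rewrite rotv_del // hform_hdel.
Qed.

Lemma halves_once_del G e : (e < nE G)%N -> halves_once G -> halves_once (del G e).
Proof.
move=> eG G1 i b /= iG; rewrite big_map -[RHS](G1 (bump e i) b).
  by apply: eq_bigr => s _; apply: count_hdel.
by rewrite /bump; lia.
Qed.

Lemma detMG_del alpha G e :
    (Defs.root G < nV G)%N -> (e < nE G)%N -> halves_once G ->
  detMG theta (alpha_rm alpha e) (del G e) =
  incdet R (nE G).-1 (nV G) (fun i j => gram alpha G (bump e i) (bump e j))
    (fun v i => inc G v (bump e i)) (Defs.root G).
Proof.
move=> rG eG G1; rewrite detMG_incdet ?nV_del //.
  by apply: eq_incdet => [i j _ _|v i vG _]; [exact: gram_del | exact: inc_del].
by rewrite -(nV_del G e); apply/balanced_inc/halves_once_del.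
Qed.

Lemma adj_sym G : symmetric (adj G).
Proof.
by move=> u v; rewrite /adj; apply: eq_existsb => e; rewrite orbC.
Qed.

(* The characteristic vector of the vertices not connected to the root lies in
   the left kernel. *)
Lemma incdet_disconnected a G : (Defs.root G < nV G)%N -> halves_once G ->
  ~ connectedG G -> incdet R (nE G) (nV G) a (inc G) (Defs.root G) = 0.
Proof.
move=> rG G1 nG; pose r := Ordinal rG.
have [/forallP rc|] := boolP [forall v, connect (adj G) r v].
  case: nG => u v; apply: connect_trans (rc v).
  by rewrite (sym_connect_sym (adj_sym G)) rc.
rewrite negb_forall => /existsP[v0 rv0].
pose z v : R := (~~ connect (adj G) r (insubd r v))%:R.
apply: (incdet_kernel _ _ _ _ _ _ z v0) => //.
- by rewrite /z valKd (negPf rv0) oner_neq0.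
- by rewrite /z (valKd r r) connect0.
move=> e eG; have zb b :
    \sum_(v < nV G) z v * (v == halfv G e b :> nat)%:R = z (halfv G e b).
  rewrite (bigD1 (Ordinal (halfv_ltn G e b G1 eG))) //= eqxx mulr1 big1 ?addr0 // => v.
  by rewrite -val_eqE /= => /negPf ->; rewrite mulr0.
under eq_bigr => v _ do rewrite inc_endpoints // mulrBr.
rewrite sumrB (zb true) (zb false) /z; apply/eqP; rewrite subr_eq0; apply/eqP.
(* The two ends of an edge lie in the same component, so [z] takes the same value at both. *)
congr (~~ _)%:R; apply: (same_connect_r (sym_connect_sym (adj_sym G))).
apply: connect1; apply/existsP; exists (Ordinal eG) => /=.
by rewrite !val_insubd !halfv_ltn // !eqxx.
Qed.

End RibbonGraphs.

(** * Contraction of the edge [e] *)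

Section Contraction.
Variables (R : realFieldType) (theta : R) (alpha : nat -> R) (G : ribbon) (e : nat).
Hypotheses (G1 : halves_once G) (eG : (e < nE G)%N) (eNloop : src G e != tgt G e).

Definition end_rot (b : bool) := let s := rotv G (halfv G e b) in rot (index (e, b) s) s.
(** For [true] and [false] these are the sequences [m1] and [m2] in [contr]. *)
Definition end_tail (b : bool) := behead (end_rot b).

Lemma halfv_neq b c : b != c -> (halfv G e b == halfv G e c) = false.
Proof.
by case: b; case: c => // _; [|rewrite eq_sym]; rewrite (negPf eNloop).
Qed.

Lemma end_rotE b : end_rot b = (e, b) :: end_tail b.
Proof.
rewrite /end_tail /end_rot /= rot_index // -has_pred1 has_count.
by rewrite count_halfv ?halfv_ltn // eqxx.
Qed.

(** The half-edge [(e, b)] was the head and occurs once; the other half of [e] sits at another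
    vertex, as [e] is not a loop. *)
Lemma end_tail_notin b c : (e, c) \notin end_tail b.
Proof.
apply/count_memPn; have : count_mem (e, c) (end_rot b) = (b == c).
  rewrite (seq.permP (introT permPl (perm_rot _ _))) count_halfv ?halfv_ltn //.
  by case: (eqVneq b c) => [<-|bc]; rewrite ?eqxx // halfv_neq.
rewrite end_rotE /= xpair_eqE eqxx /=; lia.
Qed.

Lemma hinc_end_tail b i : i != e -> hinc R (end_tail b) i = inc G (halfv G e b) i.
Proof.
move=> ie; rewrite -[RHS]/(hinc R _ _).
rewrite -[RHS](hinc_rot _ (index (e, b) (rotv G (halfv G e b)))).
rewrite -/(end_rot b) end_rotE [RHS]hinc_cons hinc1 !xpair_eqE eq_sym (negPf ie).
by rewrite subrr add0r.
Qed.

Lemma hform_end_rot b i j : i != e -> j != e ->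
  hform R (end_rot b) i j = hform R (end_tail b) i j.
Proof.
move=> ie je; rewrite end_rotE hform_cons !hinc1 !xpair_eqE ![e == _]eq_sym.
by rewrite (negPf ie) (negPf je) subrr mul0r mulr0 addr0 subr0.
Qed.

(** The half-edge of [e] comes first, so every sign in the sum is +1 and only the orientation of [e]
    remains. *)
Lemma hform_end_rot_edge b j : j != e ->
  hform R (end_rot b) e j = (-1) ^+ (~~ b) * inc G (halfv G e b) j.
Proof.
move=> je; rewrite end_rotE hform_cons hform_notin; last exact: end_tail_notin.
rewrite hinc_end_tail // [hinc R (end_tail b) e]hinc_count.
rewrite !(count_memPn (end_tail_notin _ _)) subrr mul0r subr0 add0r hinc1 !xpair_eqE eqxx.
by case: b; rewrite /= ?sub0r ?subr0.
Qed.

Definition turn v := if v == src G e then index (e, true) (rotv G v)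
  else if v == tgt G e then index (e, false) (rotv G v) else 0%N.

Lemma rot_turn v : rot (turn v) (rotv G v) =
  if v == src G e then end_rot true else if v == tgt G e then end_rot false
  else rotv G v.
Proof.
rewrite /turn; case: eqP => [->|_] //; case: eqP => [->|_] //.
exact: rot0.
Qed.

(** With [e] first at both ends, its form with [j] is a product of incidences, which a row operation
    on the vertices can clear. *)
Lemma hform_turn_edge v j : (v < nV G)%N -> j != e ->
  hform R (rot (turn v) (rotv G v)) e j = inc G v e * inc G v j.
Proof.
move=> vG je; rewrite rot_turn inc_endpoints //.
case: eqP => [->|/eqP vs]; last case: eqP => [->|/eqP vt].
- by rewrite hform_end_rot_edge // (negPf eNloop) subr0.
- by rewrite hform_end_rot_edge // sub0r.
rewrite subrr mul0r hform_notin // => b; apply/count_memPn; rewrite count_halfv //.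
by case: b; [rewrite (negPf vs) | rewrite (negPf vt)].
Qed.

Lemma rots_contr : rots (contr G e) =
  [seq hdel e (if bump (tgt G e) k == src G e then end_tail true ++ end_tail false
               else rotv G (bump (tgt G e) k)) | k <- iota 0 (nV G).-1].
Proof.
have tG : (tgt G e < nV G)%N by apply: halfv_ltn.
rewrite /contr /=; case: (nV G) tG => // m tG.
by rewrite filter_iota_neq // -map_comp.
Qed.

Lemma nV_contr : nV (contr G e) = (nV G).-1.
Proof. by rewrite /nV rots_contr size_map size_iota. Qed.

Lemma rotv_contr k : (k < (nV G).-1)%N -> rotv (contr G e) k =
  hdel e (if bump (tgt G e) k == src G e then end_tail true ++ end_tail false
          else rotv G (bump (tgt G e) k)).
Proof.
move=> kG; rewrite {1}/rotv rots_contr (nth_map 0%N) ?size_iota // nth_iota //.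
Qed.

(** The incidence matrix in the form in which [incdet_contract] produces it. *)
Definition merged_inc k i : R := let w := bump (tgt G e) k in
  inc G w (bump e i) + (w == src G e)%:R * inc G (tgt G e) (bump e i).

Lemma inc_contr k i : (k < (nV G).-1)%N -> inc (contr G e) k i = merged_inc k i.
Proof.
move=> kG; rewrite -[LHS]/(hinc R _ _) rotv_contr // hinc_hdel /merged_inc /=.
case: eqP => [->|_]; last by rewrite mul0r addr0.
by rewrite hinc_cat !hinc_end_tail ?mul1r // eq_sym neq_bump.
Qed.

Lemma sum_bump m h (F : nat -> R) : (h < m)%N ->
  \sum_(v < m) F v = F h + \sum_(k < m.-1) F (bump h k).
Proof. by move=> hm; rewrite (bigD1_ord (Ordinal hm)). Qed.

Lemma unbump_tgt_ltn v : (v < nV G)%N -> v != tgt G e ->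
  (unbump (tgt G e) v < (nV G).-1)%N.
Proof.
move=> vG vt; have tG : (tgt G e < nV G)%N by apply: (halfv_ltn _ _ false).
by move: vt; rewrite /unbump; lia.
Qed.

(** Exactly one new index stands for the merged vertex, namely [unbump (tgt G e) (src G e)]. *)
Lemma sum_merged_vertex :
  \sum_(k < (nV G).-1) (bump (tgt G e) k == src G e)%:R = 1 :> R.
Proof.
have sG : (src G e < nV G)%N by apply: (halfv_ltn _ _ true).
rewrite (bigD1 (Ordinal (unbump_tgt_ltn _ sG eNloop))) //= unbumpK // eqxx.
rewrite big1 ?addr0 // => k; rewrite -val_eqE /= => ku.
by case: eqP => // E; rewrite -E bumpK eqxx in ku.
Qed.

Lemma balanced_merged_inc : balanced R (nE G).-1 (nV G).-1 merged_inc.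
Proof.
move=> i iG; have eiG : (bump e i < nE G)%N by rewrite /bump; lia.
have tG : (tgt G e < nV G)%N by apply: (halfv_ltn _ _ false).
rewrite -[RHS](balanced_inc R _ G1 _ eiG) (sum_bump _ _ (fun v => inc G v (bump e i)) tG).
by rewrite big_split /= addrC -mulr_suml sum_merged_vertex mul1r.
Qed.

(* Rotating both ends and subtracting multiples of their rows makes the edge [e]
   interact with no other edge. *)
Definition gram_elim i j : R :=
  (if (i == e) && (j == e) then 0 else gram R theta alpha (rerot turn G) i j) +
  \sum_(v < nV G) ((i == e)%:R * (theta / 4 * inc G v e) * inc G v j
                   - inc G v i * ((j == e)%:R * (theta / 4 * inc G v e))).

(** Off the diagonal the rotated entry is [- (theta / 4)] times the sum over [v] of
    [inc G v e * inc G v j], by [hform_turn_edge]; the correction is its opposite. *)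
Lemma gram_elim_row j : gram_elim e j = 0.
Proof.
rewrite /gram_elim eqxx /=; case: (eqVneq j e) => [->|je].
  by rewrite big1 ?addr0 // => v _; rewrite mul1r mulrC subrr.
rewrite /gram eq_sym (negPf je) -[fcoef _ _ _ _]/(_ * \sum_(v < nV _) hform R _ _ _).
rewrite nV_rerot mulr_sumr -big_split big1 //= => v _.
by rewrite rotv_rerot // hform_turn_edge // !mul1r mul0r mulr0 subr0 mulNr mulrA addNr.
Qed.

Lemma fcoef_sym H i j : fcoef theta H j i = - fcoef theta H i j.
Proof.
rewrite -[LHS]/(_ * \sum_(v < nV _) hform R _ _ _).
by under eq_bigr => v _ do rewrite hform_sym; rewrite sumrN mulrN.
Qed.

Lemma gram_elim_col i : gram_elim i e = 0.
Proof.
have [->|ie] := eqVneq i e; first exact: gram_elim_row.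
have ei : (e == i) = false by rewrite eq_sym (negPf ie).
rewrite -[RHS]oppr0 -(gram_elim_row i) /gram_elim /gram eqxx ei (negPf ie) /=.
rewrite fcoef_sym opprD; congr (_ + _); rewrite -sumrN.
by apply: eq_bigr => v _; rewrite !mul0r mulr0 subr0 sub0r mulrC.
Qed.

(** Concatenating the two tails adds mixed terms at the merged vertex. They equal an [L B - B^T L^T]
    with [L] the incidence at [src G e]: the [src G e] part of [merged_inc] cancels between the two
    products. *)
Lemma gram_contr i j : gram R theta (alpha_rm alpha e) (contr G e) i j =
  gram_elim (bump e i) (bump e j) + \sum_(k < (nV G).-1)
   (- (theta / 4) * ((bump (tgt G e) k == src G e)%:R * inc G (src G e) (bump e i))
      * merged_inc k j
    - merged_inc k i *
      (- (theta / 4) * ((bump (tgt G e) k == src G e)%:R * inc G (src G e) (bump e j)))).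
Proof.
have Ne k : (bump e k == e) = false by rewrite eq_sym (negPf (neq_bump e k)).
have NeP k : bump e k != e by rewrite Ne.
rewrite /gram_elim !Ne /= [X in _ = _ + X + _]big1 ?addr0; last first.
  by move=> v _; rewrite !mul0r mulr0 subr0.
rewrite /gram alpha_rm_bump (inj_eq (can_inj (bumpK e))); case: eqP => [->|_].
  by rewrite big1 ?addr0 // => k _; rewrite mulrC subrr.
have tG : (tgt G e < nV G)%N by apply: (halfv_ltn _ _ false).
rewrite -![fcoef _ _ _ _]/(_ * \sum_(v < nV _) hform R _ _ _) nV_contr nV_rerot.
rewrite (sum_bump _ _ (fun v => hform R (rotv (rerot turn G) v) _ _) tG).
rewrite rotv_rerot // rot_turn [tgt G e == _]eq_sym (negPf eNloop) eqxx.
rewrite hform_end_rot //; set h := hform R (end_tail false) _ _.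
(* The share of the removed vertex is charged to the merged one, so that the two sums agree term by
   term. *)
have -> : h = \sum_(k < (nV G).-1) (bump (tgt G e) k == src G e)%:R * h.
  by rewrite -mulr_suml sum_merged_vertex mul1r.
rewrite -big_split !mulr_sumr -big_split /=; apply: eq_bigr => k _.
have kG : (bump (tgt G e) k < nV G)%N by have := ltn_ord k; rewrite /bump; lia.
have kt : (bump (tgt G e) k == tgt G e) = false.
  by rewrite eq_sym (negPf (neq_bump _ _)).
rewrite rotv_contr // hform_hdel rotv_rerot // rot_turn kt /merged_inc /=.
case: eqP => [->|_]; rewrite /= ?mulr1n ?mulr0n; last by ring.
rewrite hform_cat -/h hform_end_rot // !hinc_end_tail //.
rewrite -[halfv G e true]/(src G e) -[halfv G e false]/(tgt G e). ring.
Qed.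

Lemma incdet_contr rC :
  (Defs.root G < nV G)%N ->
  incdet R (nE G) (nV G)
    (fun i j => if (i == e) && (j == e) then 0 else gram R theta alpha G i j)
    (inc G) (Defs.root G) =
  detMG theta (alpha_rm alpha e) (rerot rC (contr G e)).
Proof.
move=> rG; have bG := balanced_inc R _ G1; have bC := balanced_merged_inc.
have sG : (src G e < nV G)%N by apply: (halfv_ltn _ _ true).
have tG : (tgt G e < nV G)%N by apply: (halfv_ltn _ _ false).
(* Vertex [tgt G e] is about to be eliminated, so a root there is first moved to [src G e], as
   [contr] does. *)
pose r := if Defs.root G == tgt G e then src G e else Defs.root G.
have rG' : (r < nV G)%N by rewrite /r; case: ifP.
have rt : r != tgt G e by rewrite /r; case: ifPn.
have rC_root : Defs.root (contr G e) = unbump (tgt G e) r.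
  by rewrite /= -/r /unbump; move: rt; case: ltnP; lia.
have rCm := unbump_tgt_ltn _ rG' rt.
have bC' : balanced R (nE (contr G e)) (nV G).-1 (inc (contr G e)).
  move=> i iG; rewrite -[RHS](bC i iG).
  by apply: eq_bigr => k _; rewrite inc_contr.
rewrite detMG_rerot ?rC_root ?nV_contr // detMG_incdet ?rC_root ?nV_contr //.
rewrite -(incdet_root _ _ _ _ _ _ _ bG rG rG').
transitivity (incdet R (nE G) (nV G) gram_elim (inc G) r).
  (* The first use of [incdet_form] undoes the clearing of row and column [e], the second accounts
     for the rotations by [turn]. *)
  rewrite (incdet_form _ _ _ _ _ _
    (fun i v => (i == e)%:R * (theta / 4 * inc G v e)) bG rG').
  rewrite -(incdet_form _ _ _ _ _ _ (rot_shift R theta turn G) bG rG').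
  apply: eq_incdet => // i j _ _; rewrite gram_rerot.
  case: (eqVneq i e) => [->|_] //=; case: (eqVneq j e) => [->|_] //=.
  by rewrite add0r big1 // => v _; rewrite mulrC subrr.
have -> : nE G = (nE G).-1.+1 by rewrite (ltn_predK eG).
have -> : nV G = (nV G).-1.+1 by rewrite (ltn_predK sG).
rewrite (incdet_contract _ _ _ _ _ _ e (src G e) (tgt G e));
  rewrite ?(ltn_predK eG) ?(ltn_predK sG) //; last 3 first.
- by move=> i _; apply: gram_elim_row.
- by move=> i _; apply: gram_elim_col.
- by move=> v vG; rewrite inc_endpoints.
(* A third use absorbs the mixed terms of the concatenation at the merged vertex. *)
rewrite -(incdet_form _ _ _ _ _ _ (fun i k => - (theta / 4) *
  ((bump (tgt G e) k == src G e)%:R * inc G (src G e) (bump e i))) bC rCm).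
by apply: eq_incdet => [i j _ _|k i kG _]; [rewrite gram_contr | rewrite inc_contr].
Qed.

End Contraction.

Theorem theorem5p1 (R : realFieldType) (theta : R) (alpha : nat -> R)
  (G : ribbon) (e : nat) (rD rC : nat -> nat) :
  0 < theta -> wf G -> connectedG G -> (e < nE G)%N -> src G e != tgt G e ->
  (connectedG (del G e) ->
     detMG theta alpha G =
       alpha e * detMG theta (alpha_rm alpha e) (rerot rD (del G e))
       + detMG theta (alpha_rm alpha e) (rerot rC (contr G e)))
  /\
  (~ connectedG (del G e) ->
     detMG theta alpha G =
       alpha e * 0 + detMG theta (alpha_rm alpha e) (rerot rC (contr G e))).
Proof.
move=> _ [rG G1 _] _ eG eNloop.
have D1 : halves_once (del G e) by apply: halves_once_del.
have rD_ltn : (Defs.root (del G e) < nV (del G e))%N by rewrite nV_del.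
have E : detMG theta alpha G =
    alpha e * detMG theta (alpha_rm alpha e) (rerot rD (del G e))
    + detMG theta (alpha_rm alpha e) (rerot rC (contr G e)).
  rewrite detMG_rerot //; last exact: balanced_inc.
  rewrite detMG_incdet //; last exact: balanced_inc.
  rewrite -incdet_contr // detMG_del //.
  have := incdet_delete R (nE G).-1 (nV G) (gram R theta alpha G) (inc G) (Defs.root G) e.
  by rewrite (ltn_predK eG) {2}/gram eqxx => ->.
(* The identity [E] holds whether or not [del G e] is connected; if it is not, its determinant is 0
   by [incdet_disconnected]. *)
split=> // nD; rewrite E; congr (_ * _ + _).
rewrite detMG_rerot //; last exact: balanced_inc.
by rewrite detMG_incdet ?incdet_disconnected //; apply: balanced_inc.
Qed.
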